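(* Let $X$ be a separable metrizable space. Every indecomposable connected compactification of $X$ is irreducible.
   Context: A compactification of $X$ is a compact Hausdorff space (not necessarily metrizable) in which $X$ is densely embedded. A continuum is a connected compact Hausdorff space; it is indecomposable if it cannot be written as the union of any two of its proper subcontinua (equivalently, every connected subset is either dense or nowhere dense). A composant of a continuum is the union of all its proper subcontinua that contain a given point. A continuum is irreducible if it has more than one composant, that is, if there are two points between which it is irreducible, meaning that no proper closed connected subset contains both points. *)

(* Defs.v *)
From HB Require Import structures.
From mathcomp Require Import all_boot all_order all_algebra.
From mathcomp Require Import all_classical all_reals topology.

Set Implicit Arguments.
Unset Strict Implicit.
Unset Printing Implicit Defensive.

Import Order.TTheory GRing.Theory Num.Theory.

Local Open Scope classical_set_scope.
Local Open Scope ring_scope.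

Definition is_metric (R : realType) (T : Type) (d : T -> T -> R) : Prop :=
  [/\ forall x y, 0 <= d x y,
      forall x y, d x y = 0 <-> x = y,
      forall x y, d x y = d y x
    & forall x y z, d x z <= d x y + d y z].

(* The topology of T is given beforehand; d only has to induce it. *)
Definition metrizable (R : realType) (T : topologicalType) : Prop :=
  exists2 d : T -> T -> R, is_metric d &
    forall (x : T) (A : set T),
      nbhs x A <-> exists2 e : R, 0 < e & [set y | d x y < e] `<=` A.

Definition separable_space (T : topologicalType) : Prop :=
  exists2 D : set T, countable D & dense D.

Definition embedding (X Y : topologicalType) (f : X -> Y) : Prop :=
  [/\ injective f, continuous f &
      forall U : set X, open U -> exists2 V : set Y, open V & U = f @^-1` V].

Definition compactification (X Y : topologicalType) (f : X -> Y) : Prop :=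
  [/\ hausdorff_space Y, compact [set: Y], embedding f & dense (range f)].

(* To be used in a Hausdorff space, where the subspace A is then Hausdorff.
   The library's [connected] holds of set0, which is not a continuum. *)
Definition subcontinuum (Y : topologicalType) (A : set Y) : Prop :=
  [/\ A !=set0, compact A & connected A].

Definition proper_subcontinuum (Y : topologicalType) (A : set Y) : Prop :=
  subcontinuum A /\ A <> [set: Y].

Definition indecomposable (Y : topologicalType) : Prop :=
  ~ exists A B : set Y,
      [/\ proper_subcontinuum A, proper_subcontinuum B & A `|` B = [set: Y]].

Definition composant (Y : topologicalType) (x : Y) : set Y :=
  \bigcup_(A in [set A : set Y | proper_subcontinuum A /\ A x]) A.

Definition irreducible (Y : topologicalType) : Prop :=
  exists x y : Y, composant x <> composant y.

(* Main.v *)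
Require Import Defs.
From HB Require Import structures.
From mathcomp Require Import all_boot all_order all_algebra.
From mathcomp Require Import all_classical all_reals topology.

Local Open Scope classical_set_scope.

(** Fix a point [p].  In an indecomposable continuum every proper subcontinuum
    is nowhere dense ([dense_setC_proper_subcontinuum]).  In a metrizable
    continuum one takes a countable base of nonempty open sets [W n] and writes
    the composant of [p] as the union of the components of [p] in the sets
    [~` W n]; these are countably many nowhere dense closed sets, so by the
    Baire category theorem the composant is not the whole space, and any point
    outside it has a different composant.

    A compactification [Y] of a separable metrizable space need not have a
    countable base, but the argument only asks that every nonempty open set (the
    complement of a proper subcontinuum) contain some [W n]; that is, it works
    with a countable pi-base ([irreducible_of_countable_pi_base]).  Having a
    countable pi-base passes from a densely embedded subspace to any regular
    space ([countable_pi_base_dense_embedding]): an open [W] of [Y] lies in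
    the closure of [W `&` X] by density, so when the trace of [W] is inside the
    trace of [V], [W] itself is inside [closure V], and regularity absorbs the
    closure. *)

(** * Countable pi-bases *)

Definition countable_pi_base (T : topologicalType) : Prop :=
  exists W : nat -> set T,
    (forall n, open (W n) /\ W n !=set0) /\
    (forall O : set T, open O -> O !=set0 -> exists n, W n `<=` O).

(** The balls of radius [1 / (m + 1)] around a dense sequence.  Their interiors
    are used since the hypothesis on the metric speaks of neighborhoods; the
    centers stay inside. *)
Lemma countable_pi_base_metrizable (R : realType) (X : topologicalType) :
  metrizable R X -> separable_space X -> [set: X] !=set0 ->
  countable_pi_base X.
Proof.
move=> [d [d_ge0 d_eq0 d_sym d_triangle] d_nbhs] [D D_countable D_dense].
move=> [x0 _].
have D_neq0 : D <> set0.
  move=> D0; have [|x []] := D_dense [set: X] _ openT; first by exists x0.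
  by rewrite D0.
have [//|/unsquash g] := (@pfcard_geP _ _ D [set: nat]) D_countable.
pose ball (c : nat * nat) : set X :=
  [set y | (d (g c.1) y < c.2.+1%:R^-1)%R]°.
have center_ball c : ball c (g c.1).
  apply/d_nbhs; exists (c.2.+1%:R^-1)%R => //.
  by rewrite Num.Theory.invr_gt0 Num.Theory.ltr0n.
exists (fun n => ball (odflt (0%N, 0%N) (unpickle n))); split.
  move=> n; split; first exact: open_interior.
  by eexists; exact: center_ball.
move=> O O_open [x Ox].
have /d_nbhs[e e_gt0 sub_O] : nbhs x O by exact: open_nbhs_nbhs.
(* a ball of radius less than e / 2 whose center is that close to x *)
have [m m_lt] : exists m : nat, (m.+1%:R^-1 < e / 2)%R.
  have /Num.Theory.archi_boundP : (0 <= (e / 2)^-1)%R.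
    by rewrite Num.Theory.invr_ge0 Num.Theory.divr_ge0// Order.POrderTheory.ltW.
  set m := Num.bound _ => lt_m; exists m.
  rewrite -[ltRHS]GRing.invrK Num.Theory.ltf_pV2 ?Num.Theory.posrE//.
  - by rewrite (Order.POrderTheory.lt_le_trans lt_m)// Num.Theory.ler_nat.
  - by rewrite Num.Theory.invr_gt0 Num.Theory.divr_gt0.
have [||z [xz Dz]] := D_dense [set y | (d x y < m.+1%:R^-1)%R]°.
- exists x; apply/d_nbhs; exists (m.+1%:R^-1)%R => //.
  by rewrite Num.Theory.invr_gt0 Num.Theory.ltr0n.
- exact: open_interior.
have [k _ gk] := @surj _ _ _ _ g _ Dz.
exists (pickle (k, m)); rewrite pickleK /= => y /interior_subset /=.
rewrite gk => zy; apply: sub_O => /=.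
have {}xz : (d x z < m.+1%:R^-1)%R by exact: (interior_subset xz).
apply: (Order.POrderTheory.le_lt_trans (d_triangle x z y)).
rewrite [ltRHS]Num.Theory.splitr.
by apply: Num.Theory.ltrD; exact: (Order.POrderTheory.lt_trans _ m_lt).
Qed.

Lemma regular_open_shrink (T : topologicalType) (O : set T) :
  regular_space T -> open O -> O !=set0 ->
  exists V : set T, [/\ open V, V !=set0 & closure V `<=` O].
Proof.
move=> T_regular O_open [x Ox].
have [V Vx VO] := T_regular x O (open_nbhs_nbhs (conj O_open Ox)).
exists V°; split; [exact: open_interior|by exists x|].
exact: (subset_trans (closureS (@interior_subset _ V))).
Qed.

Lemma countable_pi_base_dense_embedding (X Y : topologicalType) (f : X -> Y) :
  regular_space Y -> embedding f -> dense (range f) ->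
  countable_pi_base X -> countable_pi_base Y.
Proof.
move=> Y_regular [f_inj f_cont f_open] f_dense [U [U_open U_sub]].
have /choice[W W_of_U] : forall n, exists W, open W /\ U n = f @^-1` W.
  by move=> n; have [W] := f_open _ (U_open n).1; exists W.
exists W; split.
  move=> n; split; first exact: (W_of_U n).1.
  have [x Ux] := (U_open n).2; exists (f x).
  by rewrite (W_of_U n).2 in Ux.
move=> O O_open O_neq0.
have [V [V_open V_neq0 VO]] := regular_open_shrink _ _ Y_regular O_open O_neq0.
have [n UV] : exists n, U n `<=` f @^-1` V.
  apply: U_sub; first exact: open_comp.
  by have [y [Vy [x _ xy]]] := f_dense V V_neq0 V_open; exists x; rewrite /= xy.
exists n => y Wy; apply: VO => N.
rewrite nbhsE => -[N' [N'_open N'y] N'N].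
have [||z [[Wz N'z] [x _ xz]]] := f_dense (W n `&` N').
- by exists y.
- by apply: openI => //; exact: (W_of_U n).1.
- exists (f x); split; last by apply: N'N; rewrite xz.
  by apply: UV; rewrite (W_of_U n).2 /= xz.
Qed.

(** * The Baire category theorem in compact Hausdorff spaces *)

Lemma compact_hausdorff_regular (T : topologicalType) :
  hausdorff_space T -> compact [set: T] -> regular_space T.
Proof.
by move=> T_hausdorff T_compact x; apply: (compact_regular _ T_compact) => //;
  exact: filterT.
Qed.

(** Nonempty open sets [V n] are shrunk successively so that the closure of
    [V n.+1] lies in [V n `&` G n]; compactness provides a point in all these
    closures. *)
Lemma dense_bigcap_compact_hausdorff (T : topologicalType)
    (G : nat -> set T) :
  hausdorff_space T -> compact [set: T] ->
  (forall n, open (G n)) -> (forall n, dense (G n)) ->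
  dense (\bigcap_n G n).
Proof.
move=> T_hausdorff T_compact G_open G_dense O O_neq0 O_open.
have T_regular := compact_hausdorff_regular _ T_hausdorff T_compact.
pose good (V : set T) := open V /\ V !=set0.
have /choice[step stepP] : forall nV : nat * set T, exists V', good nV.2 ->
    good V' /\ closure V' `<=` nV.2 `&` G nV.1.
  move=> [n V]; have [V_good|V_bad] := pselect (good V); last by exists set0.
  have [|V' [V'_open V'_neq0 V'sub]] := regular_open_shrink _
      (V `&` G n) T_regular (openI V_good.1 (G_open n)).
    exact: (G_dense n V V_good.2 V_good.1).
  by exists V'.
pose V := fix V n := if n is n'.+1 then step (n', V n') else O.
have V_good n : good (V n).
  by elim: n => [//|n IHn]; exact: (stepP (n, V n) IHn).1.
have V_step n : closure (V n.+1) `<=` V n `&` G n.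
  exact: (stepP (n, V n) (V_good n)).2.
have V_decr m n : (m <= n)%N -> V n `<=` V m.
  move=> /subnK <-; elim: (n - m)%N => [//|k IHk] x Vx; apply: IHk.
  by have [] := V_step (k + m)%N x (subset_closure Vx).
pose F := filter_from [set: nat] V.
have F_proper : ProperFilter F.
  apply: filter_from_proper; last by move=> n _; exact: (V_good n).2.
  apply: filter_fromT_filter; first by exists 0%N.
  move=> i j; exists (maxn i j) => x Vx.
  by split; apply: V_decr Vx; rewrite ?leq_maxl ?leq_maxr.
have [q [_ qF]] := T_compact F F_proper filterT.
have q_V n : closure (V n) q.
  by move=> B qB; apply: qF => //; exists n.
exists q; split; first by have [] := V_step 0%N q (q_V 1%N).
by move=> n _; have [] := V_step n q (q_V n.+1).
Qed.

(** * Proper subcontinua of indecomposable continua *)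

(** A relatively clopen subset of [K `|` A] that misses [K] is closed in the
    whole space, and open because it lies in the open set [A]; hence it is
    empty.  Of any separation of [K `|` A] one side misses the connected set
    [K]. *)
Lemma connected_setU_open (T : topologicalType) (K A : set T) :
  connected [set: T] -> K !=set0 -> connected K ->
  open A -> closed (K `|` A) -> connected (K `|` A).
Proof.
move=> T_connected [k Kk] K_connected A_open KA_closed.
have miss_empty B C D : open C -> closed D -> B = (K `|` A) `&` C ->
    B = (K `|` A) `&` D -> (forall x, B x -> ~ K x) -> B = set0.
  move=> C_open D_closed BC BD B_K; apply: contrapT => /eqP/set0P B_neq0.
  have BT : B = setT.
    apply: T_connected => //.
      exists (A `&` C); first exact: openI.
      rewrite setTI BC; apply/seteqP; split => x [] => [KAx Cx|Ax Cx].
        have Bx : B x by rewrite BC.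
        by split => //; case: KAx => // /(B_K _ Bx).
      by split => //; right.
    by exists B => //; [rewrite BD; exact: closedI|rewrite setTI].
  by apply: (B_K k) => //; rewrite BT.
move=> B B_neq0 [C C_open BC] [D D_closed BD].
have [[x [Kx Bx]]|K_B] := pselect (K `&` B !=set0); last first.
  have B0 : B = set0.
    apply: (miss_empty B C D) => // x Bx Kx.
    by apply: K_B; exists x.
  by move: B_neq0 => [x]; rewrite B0.
have KB : K `&` B = K.
  apply: K_connected; first by exists x.
    by exists C => //; rewrite BC setIA (setUC K) setKU.
  by exists D => //; rewrite BD setIA (setUC K) setKU.
have setDI E : B = (K `|` A) `&` E ->
    (K `|` A) `\` B = (K `|` A) `&` ~` E.
  by move=> ->; rewrite setDIr setDv set0U setDE.
have Q0 : (K `|` A) `\` B = set0.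
  apply: (miss_empty _ (~` D) (~` C)); rewrite ?openC ?closedC//.
  - exact: setDI.
  - exact: setDI.
  - by move=> y [_ nBy]; rewrite -KB => -[].
by apply/seteqP; split; [rewrite BC => y []|rewrite -setD_eq0].
Qed.

(** If [K] contained a nonempty open set then either [~` K] is connected and its
    closure is a proper subcontinuum, or [~` K] splits into open sets [A] and
    [B] and both [K `|` A] and [K `|` B] are; either way [Y] decomposes. *)
Lemma dense_setC_proper_subcontinuum (Y : topologicalType) (K : set Y) :
  hausdorff_space Y -> compact [set: Y] -> connected [set: Y] ->
  indecomposable Y -> proper_subcontinuum K -> dense (~` K).
Proof.
move=> Y_hausdorff Y_compact Y_connected Y_indec K_proper O O_neq0 O_open.
have [[K_neq0 K_compact K_connected] K_neqT] := K_proper.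
have K_closed : closed K by exact: compact_closed.
have compact_of_closed (A : set Y) : closed A -> compact A.
  by move=> A_closed; exact: (subclosed_compact A_closed Y_compact).
apply: contrapT => O_K; apply: Y_indec.
have [CK_connected|] := pselect (connected (~` K)).
  exists K, (closure (~` K)); split => //; last first.
    apply/seteqP; split => // y _; have [Ky|nKy] := pselect (K y); first by left.
    by right; exact: subset_closure.
  split; first split.
  - apply/set0P/eqP => /closure_eq0 CK0; apply: K_neqT.
    by rewrite -[K]setCK CK0 setC0.
  - by apply: compact_of_closed; exact: closed_closure.
  - exact: connected_closure.
  - move=> CK_dense; apply: O_K; have [o Oo] := O_neq0.
    have CKo : closure (~` K) o by rewrite CK_dense.
    by rewrite setIC; apply: CKo; exact: open_nbhs_nbhs.
have CK_open : open (~` K) by rewrite openC.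
move=> /existsNP[A /not_implyP[A_neq0 /not_implyP[[C C_open AC]]]].
move=> /not_implyP[[D D_closed AD] A_neq].
pose B := ~` K `&` ~` D.
have A_open : open A by rewrite AC; exact: openI.
have B_open : open B by apply: openI => //; rewrite openC.
have B_neq0 : B !=set0.
  apply: contrapT => B0; apply: A_neq; rewrite AD; apply/seteqP.
  split => y; first by case.
  move=> nKy; split => //; apply: contrapT => nDy.
  by apply: B0; exists y.
have UA : K `|` A = ~` B.
  rewrite AD /B setCI !setCK; apply/seteqP; split => y /=; first tauto.
  by have := pselect (K y); tauto.
have UB : K `|` B = ~` A.
  rewrite AD /B setCI !setCK; apply/seteqP; split => y /=; first tauto.
  by have := pselect (K y); tauto.
have proper_setU (E E' : set Y) : open E -> open E' -> E' !=set0 ->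
    K `|` E = ~` E' -> proper_subcontinuum (K `|` E).
  move=> E_open E'_open [y E'y] KE.
  have KE_closed : closed (K `|` E) by rewrite KE closedC.
  split; first split.
  - by have [k Kk] := K_neq0; exists k; left.
  - exact: compact_of_closed.
  - exact: connected_setU_open.
  - by rewrite KE => E'T; have : (~` E') y by rewrite E'T.
exists (K `|` A), (K `|` B); split.
- exact: (proper_setU _ B).
- exact: (proper_setU _ A).
- rewrite UA; apply/seteqP; split => // y _ /=.
  by have := pselect (B y); tauto.
Qed.

(** * Composants *)

Lemma mem_composant (Y : topologicalType) (y : Y) :
  (exists y1 y2 : Y, y1 <> y2) -> composant y y.
Proof.
move=> [y1 [y2 y12]]; exists [set y] => //; split => //; split.
  by split; [exists y|exact: compact_set1|exact: connected1].
move=> yT; apply: y12.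
have [-> ->] : [set y] y1 /\ [set y] y2 by rewrite yT.
by [].
Qed.

Lemma irreducible_of_countable_pi_base (Y : topologicalType) :
  hausdorff_space Y -> compact [set: Y] -> connected [set: Y] ->
  (exists y1 y2 : Y, y1 <> y2) -> indecomposable Y ->
  countable_pi_base Y -> irreducible Y.
Proof.
move=> Y_hausdorff Y_compact Y_connected Y_nondeg Y_indec [W [W_open W_sub]].
have [p _] := Y_nondeg.
pose F n := connected_component (~` W n) p.
have F_closed n : closed (F n).
  by apply: component_closed; rewrite closedC; exact: (W_open n).1.
have F_codense n : dense (~` F n).
  have [Wp|nWp] := pselect (W n p).
    rewrite /F connected_component_out; last exact.
    by rewrite setC0 => O O_neq0 _; rewrite setIT.
  apply: dense_setC_proper_subcontinuum => //; split; first split.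
  - by exists p; exact: connected_component_refl.
  - exact: (subclosed_compact (F_closed n) Y_compact).
  - exact: component_connected.
  - move=> FT; have [y Wy] := (W_open n).2.
    have : F n y by rewrite FT.
    by move=> /connected_component_sub.
have [|||q [_ q_F]] := dense_bigcap_compact_hausdorff _ (fun n => ~` F n)
  Y_hausdorff Y_compact _ F_codense setT.
- by move=> n; rewrite openC.
- by exists p.
- exact: openT.
exists p, q => pq.
have : composant p q by rewrite pq; exact: mem_composant.
move=> [A [[[_ A_compact A_connected] A_neqT] Ap] Aq].
have [||n WA] := W_sub (~` A).
- by rewrite openC; exact: compact_closed.
- apply: contrapT => A0; apply: A_neqT; apply/seteqP; split => // y _.
  by apply: contrapT => nAy; apply: A0; exists y.
apply: (q_F n) => //; apply: (connected_component_max Ap) => //.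
by move=> y Ay Wy; exact: (WA y).
Qed.

Theorem theorem8 (R : realType) (X : topologicalType)
    (X_metrizable : metrizable R X) (X_separable : separable_space X)
    (Y : topologicalType) (f : X -> Y)
    (Y_compactification : compactification f)
    (Y_connected : connected [set: Y])
    (Y_nondegenerate : exists y1 y2 : Y, y1 <> y2)
    (Y_indecomposable : indecomposable Y) :
  irreducible Y.
Proof.
have [Y_hausdorff Y_compact f_embedding f_dense] := Y_compactification.
have [y _] := Y_nondegenerate.
have [|z [_ [x _ _]]] := f_dense setT _ openT; first by exists y.
apply: irreducible_of_countable_pi_base => //.
apply: (countable_pi_base_dense_embedding _ _ f) => //.
  exact: compact_hausdorff_regular.
by apply: (countable_pi_base_metrizable R) => //; exists x.
Qed.
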